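(* Let $n,k,d,d_p$ be positive integers with $d_p\ge n$, and let $\mathbf{P}\in\mathbb{R}^{n\times d_p}$ have orthonormal rows. Let $L:\mathbb{R}^{n^k\times d}\to\mathbb{R}^{n^k\times d}$ be any order-$k$ equivariant linear layer. Then for every compact set $K\subset\mathbb{R}^{n^k\times d}$ and every $\delta>0$ there exist a type identifier dimension $d_e$, type identifiers $\mathbf{E}^\gamma\in\mathbb{R}^{d_e}$ (one per order-$k$ equivalence class $\gamma$), a hidden dimension $d_{\mathcal{T}}\ge d$, an input projection $w^{in}\in\mathbb{R}^{(d+kd_p+d_e)\times d_{\mathcal{T}}}$, and a Transformer layer $\mathcal{T}:\mathbb{R}^{n^k\times d_{\mathcal{T}}}\to\mathbb{R}^{n^k\times d_{\mathcal{T}}}$ with $\mathrm{bell}(2k)$ self-attention heads such that for all $\mathbf{X}\in K$ and all $\mathbf{i}\in[n]^k$, the first $d$ coordinates of $\mathcal{T}(\mathbf{X}^{in}w^{in})_{\mathbf{i}}$ are within distance $\delta$ of $L(\mathbf{X})_{\mathbf{i}}$.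
   Context: Equivalence classes: for $l\ge1$, $\mathbf{i}\sim\mathbf{j}$ in $[n]^l$ iff $\mathbf{i}=(\pi(j_1),\dots,\pi(j_l))$ for some $\pi\in S_n$; order-$l$ equivalence classes are the elements of $[n]^l/_\sim$ (there are $\mathrm{bell}(l)$ of them for $n\ge l$, where $\mathrm{bell}$ denotes the Bell numbers). The basis tensor of an order-$l$ class $\gamma$ is $\mathbf{B}^\gamma\in\mathbb{R}^{n^l}$ with $\mathbf{B}^\gamma_{\mathbf{i}}=1$ if $\mathbf{i}\in\gamma$, else $0$. An order-$k$ equivariant linear layer $L:\mathbb{R}^{n^k\times d}\to\mathbb{R}^{n^k\times d}$ is a map of the form $L(\mathbf{X})_{\mathbf{i}}=\sum_{\mu}\sum_{\mathbf{j}\in[n]^k}\mathbf{B}^\mu_{\mathbf{i},\mathbf{j}}\mathbf{X}_{\mathbf{j}}w_\mu+\sum_{\lambda}\mathbf{C}^\lambda_{\mathbf{i}}b_\lambda$, where $\mu$ ranges over order-$2k$ classes with basis tensors $\mathbf{B}^\mu$ (entry $\mathbf{B}^\mu_{\mathbf{i},\mathbf{j}}$ at the concatenated index $(\mathbf{i},\mathbf{j})$), $\lambda$ ranges over order-$k$ classes with basis tensors $\mathbf{C}^\lambda$, and $w_\mu\in\mathbb{R}^{d\times d}$, $b_\lambda\in\mathbb{R}^d$ are arbitrary. Augmentation: $\mathbf{X}^{in}_{\mathbf{i}}=[\mathbf{X}_{\mathbf{i}},\mathbf{P}_{i_1},\dots,\mathbf{P}_{i_k},\mathbf{E}^{\gamma}]$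 where $\gamma\ni\mathbf{i}$. A Transformer layer (without layer normalization) acting on $\mathbf{Z}\in\mathbb{R}^{N\times d_{\mathcal{T}}}$, $N=n^k$, is $\mathcal{T}(\mathbf{Z})=\mathbf{H}+\mathrm{MLP}(\mathbf{H})$ with $\mathbf{H}=\mathbf{Z}+\mathrm{MSA}(\mathbf{Z})$, where $\mathrm{MSA}(\mathbf{Z})_{\mathbf{i}}=\sum_{h=1}^H\sum_{\mathbf{j}}\boldsymbol{\alpha}^h_{\mathbf{i},\mathbf{j}}\mathbf{Z}_{\mathbf{j}}w^V_hw^O_h$, $\boldsymbol{\alpha}^h=\mathrm{softmax}\big((\mathbf{Z}w^Q_h+\mathbf{1}(b^Q_h)^\top)(\mathbf{Z}w^K_h+\mathbf{1}(b^K_h)^\top)^\top/\sqrt{d_H}\big)$ (row-wise softmax), $w^Q_h,w^K_h\in\mathbb{R}^{d_{\mathcal{T}}\times d_H}$, $w^V_h\in\mathbb{R}^{d_{\mathcal{T}}\times d_v}$, $w^O_h\in\mathbb{R}^{d_v\times d_{\mathcal{T}}}$, and $\mathrm{MLP}$ is a tokenwise (same for every row) feedforward network of arbitrary width with a fixed continuous non-polynomial activation. *)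

(* Defs.v *)
From HB Require Import structures.
From mathcomp Require Import all_boot all_order all_algebra all_fingroup.
From mathcomp Require Import all_classical all_reals all_analysis.
Set Implicit Arguments. Unset Strict Implicit. Unset Printing Implicit Defensive.
Import Order.TTheory GRing.Theory Num.Theory.
Local Open Scope ring_scope.

Fixpoint stirling2 (m j : nat) : nat :=
  match m, j with
  | 0, 0 => 1
  | 0, _.+1 => 0
  | _.+1, 0 => 0
  | m'.+1, j'.+1 => j'.+1 * stirling2 m' j'.+1 + stirling2 m' j'
  end%N.

Definition bell (m : nat) : nat := (\sum_(j < m.+1) stirling2 m j)%N.

Definition idx (n l : nat) := {ffun 'I_l -> 'I_n}.

Definition act_idx (n l : nat) (pi : {perm 'I_n}) (i : idx n l) : idx n l :=
  [ffun t => pi (i t)].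

Definition eqclass (n l : nat) (i : idx n l) : {set idx n l} :=
  [set j | [exists pi : {perm 'I_n}, j == act_idx pi i]].

Definition classes (n l : nat) : {set {set idx n l}} :=
  [set eqclass i | i : idx n l].

Definition basis_tensor (R : ringType) (n l : nat) (gamma : {set idx n l})
  (i : idx n l) : R := (i \in gamma)%:R.

Definition cat_idx (n k : nat) (i j : idx n k) : idx n (k + k) :=
  [ffun t : 'I_(k + k) => match fintype.split t with inl a => i a | inr b => j b end].

(* Order-k equivariant linear layer with weights w_mu (mu order-2k class) and
   biases b_lambda (lambda order-k class); X is an element of R^{n^k x d},
   represented as a map from [n]^k to row vectors of length d. *)
Definition eq_layer (R : ringType) (n k d : nat)
  (w : {set idx n (k + k)} -> 'M[R]_(d, d)) (b : {set idx n k} -> 'rV[R]_d)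
  (X : idx n k -> 'rV[R]_d) (i : idx n k) : 'rV[R]_d :=
  \sum_(mu in classes n (k + k)) \sum_(j : idx n k)
      basis_tensor R mu (cat_idx i j) *: (X j *m w mu)
  + \sum_(lam in classes n k) basis_tensor R lam i *: b lam.

(* Augmented input X^in_i = [X_i, P_{i_1}, ..., P_{i_k}, E^gamma], gamma the
   class of i; the k positional rows are concatenated by mxvec (row-major). *)
Definition augment (R : ringType) (n k d dp de : nat) (P : 'M[R]_(n, dp))
  (E : {set idx n k} -> 'rV[R]_de) (X : idx n k -> 'rV[R]_d) (i : idx n k)
  : 'rV[R]_(d + k * dp + de) :=
  row_mx (row_mx (X i) (mxvec (\matrix_(a < k, c < dp) P (i a) c)))
         (E (eqclass i)).

Record attn_head (R : Type) (dT dH dv : nat) := Head {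
  wQ : 'M[R]_(dT, dH); bQ : 'rV[R]_dH;
  wK : 'M[R]_(dT, dH); bK : 'rV[R]_dH;
  wV : 'M[R]_(dT, dv); wO : 'M[R]_(dv, dT) }.

Record mlp (R : Type) (dT m : nat) := MLP {
  W1 : 'M[R]_(dT, m); b1 : 'rV[R]_m;
  W2 : 'M[R]_(m, dT); b2 : 'rV[R]_dT }.

Section Transformer.
Variables (R : realType) (I : finType) (dT dH dv : nat).

Definition attn_score (h : attn_head R dT dH dv) (Z : I -> 'rV[R]_dT) (i j : I) : R :=
  ((Z i *m wQ h + bQ h) *m (Z j *m wK h + bK h)^T) 0 0 / Num.sqrt (dH%:R).

Definition attn (h : attn_head R dT dH dv) (Z : I -> 'rV[R]_dT) (i j : I) : R :=
  expR (attn_score h Z i j) / \sum_(j' : I) expR (attn_score h Z i j').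

Definition msa (H : nat) (hs : 'I_H -> attn_head R dT dH dv) (Z : I -> 'rV[R]_dT)
  (i : I) : 'rV[R]_dT :=
  \sum_(h < H) \sum_(j : I) attn (hs h) Z i j *: (Z j *m wV (hs h) *m wO (hs h)).

Definition mlp_apply (sigma : R -> R) (m : nat) (M : mlp R dT m)
  (z : 'rV[R]_dT) : 'rV[R]_dT :=
  map_mx sigma (z *m W1 M + b1 M) *m W2 M + b2 M.

(* Transformer layer without layer normalization:
   T(Z) = H + MLP(H), H = Z + MSA(Z). *)
Definition transformer (sigma : R -> R) (H : nat) (hs : 'I_H -> attn_head R dT dH dv)
  (m : nat) (M : mlp R dT m) (Z : I -> 'rV[R]_dT) (i : I) : 'rV[R]_dT :=
  let Hz := Z i + msa hs Z i in Hz + mlp_apply sigma M Hz.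

End Transformer.

Definition eucl_dist (R : realType) (d : nat) (u v : 'rV[R]_d) : R :=
  Num.sqrt (\sum_(c < d) (u 0 c - v 0 c) ^+ 2).

Lemma bell_small : [:: bell 0; bell 1; bell 2; bell 3; bell 4] = [:: 1; 1; 2; 5; 15]%N.
Proof. by rewrite /bell !big_ord_recr !big_ord0. Qed.

(* Main.v *)
Require Import Defs.
From HB Require Import structures.
From mathcomp Require Import all_boot all_order all_algebra all_fingroup.
From mathcomp Require Import all_classical all_reals all_analysis.
From mathcomp Require Import ring lra.
Import Order.TTheory GRing.Theory Num.Theory.
Import numFieldNormedType.Exports.
Local Open Scope ring_scope.

(** There is one attention head per order-[2k] class [mu].  If [(p, q)] is in [mu]
    and [i] is in the class of [p], then [(i, j)] is in [mu] exactly when [j] has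
    the class of [q] and [i_a = j_b <-> p_a = q_b] for all [a], [b].  Since the
    rows of [P] are orthonormal, the number of violated conditions is, up to a
    constant, bilinear in the tokens, so a sharp softmax averages uniformly over
    [{j | (i, j) in mu}]; the cardinality of this set depends only on [mu] and is
    absorbed into the value weights.

    When [i] is not in the class of [p] the head returns garbage, which the MLP has
    to switch off: it must compute [(g, x) |-> g x] for [g] in [{0, 1}].  For a
    continuous nonaffine activation there are [h], [p], [q] with
    [D p <> D q], where [D t = sigma (t + h) - sigma t].  The window average
    [F t] of [sigma] over [[t, t + h]] has slope proportional to [D t] and is a
    limit of Riemann sums, i.e. of one-layer networks; hence
    [F (p + g (q - p) + eps x) - F (p + g (q - p))], minus its value at [g = 0],
    is a multiple of [g x] up to a small error.  *)

Set Implicit Arguments.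
Unset Strict Implicit.

(** * Gating by a continuous nonpolynomial activation *)

Lemma normr_sum_le (R : realType) (I : finType) (F : I -> R) (B : R) :
  (forall i, `|F i| <= B) -> `|\sum_i F i| <= #|I|%:R * B.
Proof.
move=> FB; apply: le_trans (ler_norm_sum _ _ _) _.
by rewrite mulr_natl -sumr_const; apply: ler_sum.
Qed.

Section Gate.
Variables (R : realType) (sigma : R -> R).
Hypothesis sigma_cont : continuous sigma.

Lemma continuous_eps_delta (x e : R) : 0 < e ->
  exists2 r : R, 0 < r & forall y, `|y - x| < r -> `|sigma y - sigma x| < e.
Proof.
move=> e0.
have /cvgrPdist_lt/(_ e e0) := @sigma_cont x.
rewrite -nbhs_ballE /= => -[r /= r0 Hr]; exists r => // y hy.
by rewrite distrC; apply: Hr; rewrite /ball /= distrC.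
Qed.

(** Heine-Cantor: half of the continuity radius at a point serves all nearby base points, and the
    covering form of compactness extracts one radius for the segment. *)
Lemma segment_unif_continuous (a b e : R) : 0 < e ->
  exists2 r : R, 0 < r & forall x y, a <= x <= b -> `|y - x| < r ->
    `|sigma y - sigma x| < e.
Proof.
move=> e0.
have /compact_near_coveringP cov := @segment_compact R a b.
pose Q (r x : R) := forall y, `|y - x| < r -> `|sigma y - sigma x| < e.
have key : \forall r \near at_right (0 : R), (`[a, b] `<=` Q r)%classic.
  apply: cov => x _.
  have [r r0 Hr] : exists2 r : R, 0 < r &
      forall y, `|y - x| < r -> `|sigma y - sigma x| < e / 2.
    by apply: continuous_eps_delta; lra.
  exists (ball x (r / 2), [set s | s < r / 2]%classic).
    split; first by apply: nbhsx_ballx; lra.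
    by apply: nbhs_right_lt; lra.
  move=> [x' s] /= [xx' sr] y yx'.
  have x'x : `|x' - x| < r / 2 by rewrite distrC.
  have h1 : `|x' - x| < r by lra.
  have h2 : `|y - x| < r.
    have -> : y - x = (y - x') + (x' - x) by ring.
    by apply: le_lt_trans (ler_normD _ _) _; lra.
  have := Hr _ h1; have := Hr _ h2 => {h1 h2}h2 h1.
  have -> : sigma y - sigma x' = (sigma y - sigma x) - (sigma x' - sigma x) by ring.
  by apply: le_lt_trans (ler_normB _ _) _; lra.
near (at_right (0 : R)) => r.
exists r; first by near: r; exact: nbhs_right_gt.
move=> x y xab; have: (`[a, b] `<=` Q r)%classic by near: r.
by apply; rewrite /= in_itv.
Unshelve. all: by end_near. Qed.

(* The excess of an additive function over its linear part vanishes at [1/N],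
   hence is [1/N]-periodic, hence bounded, hence zero. *)
Lemma continuous_additive_linear (f : R -> R) :
  (forall e, 0 < e -> exists2 r : R, 0 < r & forall y, `|y| < r -> `|f y| < e) ->
  (forall x y, f (x + y) = f x + f y) -> forall x, f x = f 1 * x.
Proof.
move=> f_cont fD.
have f0 : f 0 = 0 by have := fD 0 0; rewrite addr0; lra.
have fMn (m : nat) x : f (m%:R * x) = m%:R * f x.
  elim: m => [|m IH]; first by rewrite !mul0r.
  by rewrite -!natr1 !mulrDl !mul1r fD IH.
have fN x : f (- x) = - f x by have := fD x (- x); rewrite subrr f0; lra.
pose g x := f x - f 1 * x.
have gD x y : g (x + y) = g x + g y by rewrite /g fD; ring.
have gMn (m : nat) x : g (m%:R * x) = m%:R * g x by rewrite /g fMn; ring.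
have gN x : g (- x) = - g x by rewrite /g fN; ring.
have g1 : g 1 = 0 by rewrite /g; ring.
have [r r0 Hr] := f_cont 1 ltr01.
have [N N0 Nr] : exists2 N : nat, (0 < N)%N & N%:R^-1 < r.
  exists (Num.truncn r^-1).+1 => //.
  rewrite -[ltRHS]invrK ltf_pV2 ?posrE ?invr_gt0 ?ltr0n //.
  by have /andP[] := @truncn_itv R r^-1 (ltW (etrans (invr_gt0 r) r0)).
have NR : 0 < N%:R :> R by rewrite ltr0n.
have gV : g N%:R^-1 = 0.
  have := gMn N N%:R^-1; rewrite mulfV ?gt_eqF // g1 => /esym/eqP.
  by rewrite mulf_eq0 gt_eqF //= => /eqP.
have g_bound x : `|g x| <= 1 + `|f 1|.
  wlog x0 : x / 0 <= x.
    move=> H; case: (leP 0 x) => [/H //|/ltW x0].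
    by rewrite -normrN -gN; apply: H; rewrite oppr_ge0.
  set m := Num.truncn (x * N%:R).
  have /andP[mx xm] := @truncn_itv R (x * N%:R) (mulr_ge0 x0 (ltW NR)).
  rewrite -/m in mx xm.
  have t0 : 0 <= x - m%:R / N%:R by rewrite subr_ge0 ler_pdivrMr.
  have t1 : x - m%:R / N%:R < N%:R^-1.
    by move: xm; rewrite -ltr_pdivlMr // -natr1 mulrDl mul1r; lra.
  have t1' : x - m%:R / N%:R <= 1.
    by apply: le_trans (ltW t1) _; rewrite invf_le1 // ler1n.
  have -> : g x = g (x - m%:R / N%:R).
    have := gD (x - m%:R / N%:R) (m%:R / N%:R).
    by rewrite subrK (gMn m) gV mulr0 addr0.
  rewrite /g; apply: le_trans (ler_normB _ _) _; apply: lerD.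
    by apply/ltW/Hr; rewrite ger0_norm //; apply: lt_trans t1 _.
  by rewrite normrM (ger0_norm t0) ler_piMr.
move=> x; apply/eqP; rewrite -subr_eq0; apply/eqP; rewrite -/(g x).
apply/eqP/negPn/negP => gx0.
have gx : 0 < `|g x| by rewrite normr_gt0.
set B := 1 + `|f 1| in g_bound.
have B0 : 0 <= B / `|g x| by apply: divr_ge0 => //; rewrite /B addr_ge0.
have /andP[_] := @truncn_itv R (B / `|g x|) B0.
set m := (Num.truncn _).+1; rewrite ltr_pdivrMr // => hB.
have := g_bound (m%:R * x); rewrite gMn normrM normr_nat; lra.
Qed.

(** Otherwise no increment depends on its base point, so [sigma x - sigma 0] is additive and
    continuous, hence linear, and [sigma] is a polynomial of degree at most one. *)
Lemma nonaffine_increment :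
  (~ exists p : {poly R}, forall x, sigma x = p.[x]) ->
  exists h p q : R, 0 < h /\
    sigma (p + h) - sigma p <> sigma (q + h) - sigma q.
Proof.
move=> nonpoly; apply: contrapT => noinc; apply: nonpoly.
have incp h p q : 0 < h -> sigma (p + h) - sigma p = sigma (q + h) - sigma q.
  move=> h0; apply: contrapT => H; apply: noinc.
  by exists h, p, q.
have inc h p q : sigma (p + h) - sigma p = sigma (q + h) - sigma q.
  case: (ltgtP h 0) => [h0|h0|->]; last by rewrite !addr0; ring.
    have h0' : 0 < - h by rewrite oppr_gt0.
    by have := incp _ (p + h) (q + h) h0'; rewrite !addrK; lra.
  exact: incp.
have lin := @continuous_additive_linear (fun x => sigma x - sigma 0) _ _.
exists ((sigma 1 - sigma 0) *: 'X + (sigma 0)%:P) => x.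
rewrite !hornerE -lin ?subrK //.
  move=> e e0; have [r r0 Hr] := continuous_eps_delta 0 e0.
  by exists r => // y yr; apply: Hr; rewrite subr0.
by move=> a b; have := inc b a 0; rewrite add0r; lra.
Qed.


(** Both sides are the sum of [f] over [0, N + m) minus its sums over [0, N) and over [0, m). *)
Lemma sum_shift (f : nat -> R) (N m : nat) :
  \sum_(a < N) (f (a + m)%N - f a) = \sum_(j < m) (f (N + j)%N - f j).
Proof.
elim: m => [|m IH].
  by rewrite big_ord0 big1 // => a _; rewrite addn0 subrr.
rewrite big_ord_recr /= -IH.
elim: N {IH} => [|N IH]; first by rewrite !big_ord0 add0n subrr addr0.
by rewrite !big_ord_recr /= IH addSn addnS; ring.
Qed.

(* On the lattice [p0 + eta N] the sum telescopes into increments over [h];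
   the modulus [om] accounts for points off the lattice. *)
Lemma riemann_increment (h eta p0 y D kap om : R) (N : nat) :
  h = N%:R * eta -> 0 < eta -> 0 <= y ->
  (forall t, p0 <= t <= p0 + y -> `|sigma (t + h) - sigma t - D| <= kap) ->
  (forall s t, p0 <= t <= p0 + y + h -> `|s - t| <= eta ->
    `|sigma s - sigma t| <= om) ->
  `|eta * (\sum_(a < N) (sigma (p0 + y + a%:R * eta) - sigma (p0 + a%:R * eta)))
     - y * D| <= y * kap + h * om + eta * `|D|.
Proof.
move=> hE eta0 y0 Hkap Hom.
have /andP[] := @truncn_itv R (y / eta) (divr_ge0 y0 (ltW eta0)).
set m := Num.truncn _; rewrite ler_pdivlMr // ltr_pdivrMr // -natr1 => my ym.
have kap0 : 0 <= kap by apply: le_trans (Hkap p0 _); rewrite // lexx lerDl.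
(* Here [m] is the number of whole lattice steps in [y]. The three summands are the cost of rounding
   [y] to [m * eta], the deviation of [m] lattice increments from [D], and the leftover of [y]; they
   yield [h * om], [y * kap] and [eta * |D|]. *)
have -> : eta * (\sum_(a < N) (sigma (p0 + y + a%:R * eta) - sigma (p0 + a%:R * eta)))
     - y * D =
  eta * (\sum_(a < N) (sigma (p0 + y + a%:R * eta) - sigma (p0 + (a + m)%:R * eta)))
  + eta * (\sum_(j < m) (sigma (p0 + j%:R * eta + h) - sigma (p0 + j%:R * eta) - D))
  - (y - m%:R * eta) * D.
  have -> : \sum_(j < m) (sigma (p0 + j%:R * eta + h) - sigma (p0 + j%:R * eta) - D) =
    \sum_(a < N) (sigma (p0 + (a + m)%:R * eta) - sigma (p0 + a%:R * eta)) - m%:R * D.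
    rewrite (@sum_shift (fun a => sigma (p0 + a%:R * eta))) sumrB sumr_const.
    rewrite card_ord -[D *+ m]mulr_natl; congr (_ - _); apply: eq_bigr => j _.
    by rewrite hE natrD mulrDl; congr (sigma _ - _); ring.
  rewrite mulrBr addrA -mulrDr -big_split /=.
  under [in RHS]eq_bigr do rewrite addrA subrK.
  by ring.
apply: le_trans (ler_normB _ _) _; rewrite normrM.
apply: lerD; last first.
  apply: ler_wpM2r => //; rewrite ger0_norm ?subr_ge0 //; lra.
apply: le_trans (ler_normD _ _) _; rewrite !normrM (gtr0_norm eta0) addrC.
apply: lerD.
  apply: (@le_trans _ _ (eta * (m%:R * kap))); last first.
    by rewrite mulrA [eta * _]mulrC ler_wpM2r.
  apply: ler_wpM2l; first exact: ltW.
  have -> : m%:R = #|'I_m|%:R :> R by rewrite card_ord.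
  apply: normr_sum_le => j.
  apply: Hkap; have jm : (j : nat)%:R <= m%:R :> R by rewrite ler_nat ltnW.
  have := ler_wpM2r (ltW eta0) jm.
  have : 0 <= (j : nat)%:R * eta by rewrite mulr_ge0 // ltW.
  lra.
have -> : h * om = eta * (N%:R * om) by rewrite hE; ring.
apply: ler_wpM2l; first exact: ltW.
have -> : N%:R = #|'I_N|%:R :> R by rewrite card_ord.
apply: normr_sum_le => a.
have aN : (a : nat)%:R <= N%:R :> R by rewrite ler_nat ltnW.
have := ler_wpM2r (ltW eta0) aN; rewrite -hE => aN'.
have a0 : 0 <= (a : nat)%:R * eta by rewrite mulr_ge0 // ltW.
have m0 : 0 <= m%:R * eta by rewrite mulr_ge0 // ltW.
apply: Hom; rewrite natrD mulrDl; first by lra.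
by rewrite ler_norml; lra.
Qed.

(** Riemann sum of step [h / N] for the integral of [sigma] over the window of length [h] from
    [t + eps * x] minus that from [t], divided by [eps]. *)
Definition slope_sum (h eps : R) (N : nat) (t x : R) : R :=
  h / N%:R / eps * \sum_(a < N)
    (sigma (t + eps * x + a%:R * (h / N%:R)) - sigma (t + a%:R * (h / N%:R))).

(** The window integral has derivative [sigma (p + h) - sigma p] at [p]. The step count is chosen
    after [eps], since the Riemann error gets divided by [eps]; all small [eps] and large [N] are
    allowed so that two base points can share them. *)
Lemma slope_sum_approx (h p A delta : R) : 0 < h -> 0 < A -> 0 < delta ->
  exists2 eps0 : R, 0 < eps0 & forall eps, 0 < eps <= eps0 ->
  exists N0 : nat, forall N, (N0 <= N)%N -> forall x, `|x| <= A ->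
    `|slope_sum h eps N p x - (sigma (p + h) - sigma p) * x| <= delta.
Proof.
move=> h0 A0 delta0; set D := sigma (p + h) - sigma p.
(* Two applications of [riemann_increment] may each cost [eps * delta / 2]: a quarter of
   [eps * delta] from [kap], an eighth from [om] and an eighth from the lattice spacing. *)
pose kap := delta / (8 * A).
have kap0 : 0 < kap by rewrite divr_gt0 // mulr_gt0.
have kap2 : 0 < kap / 2 by lra.
have [r1 r10 H1] := continuous_eps_delta p kap2.
have [r2 r20 H2] := continuous_eps_delta (p + h) kap2.
pose r := Num.min r1 r2.
have rr : 0 < r by rewrite lt_min r10.
have Hkap t : `|t - p| < r -> `|sigma (t + h) - sigma t - D| <= kap.
  rewrite lt_min => /andP[/H1 t1 t2].
  have /H2 t3 : `|t + h - (p + h)| < r2 by have -> : t + h - (p + h) = t - p by ring.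
  have -> : sigma (t + h) - sigma t - D =
    (sigma (t + h) - sigma (p + h)) - (sigma t - sigma p) by rewrite /D; ring.
  by apply: le_trans (ler_normB _ _) _; lra.
exists (r / (2 * A)); first by rewrite divr_gt0 // mulr_gt0.
move=> eps /andP[eps0]; rewrite ler_pdivlMr ?mulr_gt0 // => epsr.
have epsA : 0 < eps * A by rewrite mulr_gt0.
pose om := eps * delta / (8 * h).
have om0 : 0 < om by rewrite divr_gt0 ?mulr_gt0.
have [s s0 Hs] := segment_unif_continuous (p - eps * A) (p + eps * A + h) om0.
pose bnd := Num.min s (eps * delta / (8 * (1 + `|D|))).
have D0 : 0 < 1 + `|D| by apply: ltr_pwDl.
have bnd0 : 0 < bnd by rewrite lt_min s0 divr_gt0 ?mulr_gt0.
exists (Num.truncn (h / bnd)).+1 => N N0 x xA.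
have NR : 0 < N%:R :> R by rewrite ltr0n (leq_trans _ N0).
pose eta := h / N%:R.
have eta0 : 0 < eta by rewrite divr_gt0.
have hE : h = N%:R * eta by rewrite /eta mulrC divfK // gt_eqF.
have etab : eta < bnd.
  rewrite ltr_pdivrMr // mulrC -ltr_pdivrMr //.
  have /andP[_ hb] := @truncn_itv R (h / bnd) (divr_ge0 (ltW h0) (ltW bnd0)).
  by apply: lt_le_trans hb _; rewrite ler_nat.
move: (etab); rewrite lt_min => /andP[etas]; rewrite ltr_pdivlMr ?mulr_gt0 // => etaD.
have key y : 0 <= y <= 2 * (eps * A) ->
  `|eta * (\sum_(a < N) (sigma (p - eps * A + y + a%:R * eta)
                          - sigma (p - eps * A + a%:R * eta))) - y * D|
    <= eps * (delta / 2).
  move=> /andP[y0 y1].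
  have := @riemann_increment h eta (p - eps * A) y D kap om N hE eta0 y0.
  move=> /(_ _ _) H; apply: le_trans (H _ _) _.
  - move=> t tb; apply: Hkap; rewrite ltr_norml; lra.
  - move=> u t tb ut; apply/ltW/Hs; first by lra.
    exact: le_lt_trans ut etas.
  - have h1 : y * kap <= eps * (delta / 4).
      apply: le_trans (ler_wpM2r (ltW kap0) y1) _.
      rewrite /kap; have -> : 2 * (eps * A) * (delta / (8 * A)) = eps * (delta / 4).
        by field; rewrite gt_eqF.
      exact: lexx.
    have h2 : h * om = eps * (delta / 8) by rewrite /om; field; rewrite gt_eqF.
    have h3 : eta * `|D| <= eps * (delta / 8) by lra.
    lra.
(* [riemann_increment] wants a nonnegative displacement, while [x] has any sign: starting from
   [p - eps * A], the displacements [eps * A + eps * x] and [eps * A] are subtracted. *)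
have -> : slope_sum h eps N p x - D * x = eps^-1 * (
  (eta * (\sum_(a < N) (sigma (p - eps * A + (eps * A + eps * x) + a%:R * eta)
          - sigma (p - eps * A + a%:R * eta))) - (eps * A + eps * x) * D)
 - (eta * (\sum_(a < N) (sigma (p - eps * A + eps * A + a%:R * eta)
          - sigma (p - eps * A + a%:R * eta))) - (eps * A) * D)).
  have -> : p - eps * A + (eps * A + eps * x) = p + eps * x by ring.
  rewrite subrK /slope_sum -/eta !sumrB.
  by field; rewrite gt_eqF.
rewrite normrM gtr0_norm ?invr_gt0 // ler_pdivrMl //.
have epsx : eps * `|x| <= eps * A by rewrite ler_pM2l.
have : `|eps * x| <= eps * A by rewrite normrM (gtr0_norm eps0).
rewrite ler_norml => /andP[x1 x2].
apply: le_trans (ler_normB _ _) _.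
have -> : eps * delta = eps * (delta / 2) + eps * (delta / 2) by field.
by apply: lerD; apply: key; lra.
Qed.

(** The shift [e] is what the gate bit multiplies. Without it the neurons cancel in pairs, exactly
    and for every [x]; with it half of them move from base [p] to base [q], and the difference of
    the two slopes, normalized to one, remains. *)
Lemma gate_network (A delta : R) :
  (~ exists p : {poly R}, forall x, sigma x = p.[x]) ->
  0 < A -> 0 < delta ->
  exists (Q : finType) (c a b e : Q -> R),
    (forall x, \sum_q c q * sigma (a q * x + b q) = 0) /\
    (forall x, `|x| <= A ->
      `|\sum_q c q * sigma (a q * x + b q + e q) - x| <= delta).
Proof.
move=> /nonaffine_increment[h [p [q [h0 Dpq]]]] A0 delta0.
set Dp := sigma (p + h) - sigma p in Dpq.
set Dq := sigma (q + h) - sigma q in Dpq.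
have Dne : Dq - Dp != 0 by rewrite subr_eq0; apply/eqP => H; apply: Dpq.
have dD : 0 < `|Dq - Dp| * (delta / 2) by rewrite mulr_gt0 ?normr_gt0 //; lra.
have [e1 e10 H1] := slope_sum_approx p h0 A0 dD.
have [e2 e20 H2] := slope_sum_approx q h0 A0 dD.
pose eps := Num.min e1 e2.
have eps0 : 0 < eps by rewrite lt_min e10.
have [|N1 {}H1] := H1 eps; first by rewrite eps0 ge_min lexx.
have [|N2 {}H2] := H2 eps; first by rewrite eps0 ge_min lexx orbT.
pose N := maxn N1 N2.
pose eta := h / N%:R.
pose K := eta / eps / (Dq - Dp).
exists ('I_N * bool * bool)%type.
(* In [(a, u, v)], [a] is the Riemann node, [u] drops the input and [v] drops the shift to [q]; each
   of [u] and [v] costs a sign. *)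
exists (fun t : 'I_N * bool * bool => K * (-1) ^+ t.1.2 * (-1) ^+ t.2).
exists (fun t : 'I_N * bool * bool => if t.1.2 then 0 else eps).
exists (fun t : 'I_N * bool * bool => p + (t.1.1 : nat)%:R * eta).
exists (fun t : 'I_N * bool * bool => if t.2 then 0 else q - p).
have sum3 (G : 'I_N -> bool -> bool -> R) :
  \sum_(t : 'I_N * bool * bool) G t.1.1 t.1.2 t.2 =
  \sum_a (G a true true + G a true false + (G a false true + G a false false)).
  rewrite -(pair_bigA _ (fun au v => G au.1 au.2 v)) /=.
  rewrite -(pair_bigA _ (fun a u => \sum_v G a u v)) /=.
  by apply: eq_bigr => a _; rewrite !big_bool.
split=> x.
  rewrite (sum3 (fun a u v => K * (-1) ^+ u * (-1) ^+ v *
    sigma ((if u then 0 else eps) * x + (p + (a : nat)%:R * eta)))).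
  by apply: big1 => a _; rewrite /= !expr0 !expr1; ring.
move=> xA; rewrite (sum3 (fun a u v => K * (-1) ^+ u * (-1) ^+ v *
    sigma ((if u then 0 else eps) * x + (p + (a : nat)%:R * eta)
      + (if v then 0 else q - p)))).
have Nle1 : (N1 <= N)%N by rewrite leq_maxl.
have Nle2 : (N2 <= N)%N by rewrite leq_maxr.
have {}H1 := H1 N Nle1 x xA; have {}H2 := H2 N Nle2 x xA.
rewrite -/Dp in H1; rewrite -/Dq in H2.
rewrite [X in `|X - x|](_ : _ =
  (slope_sum h eps N q x - slope_sum h eps N p x) / (Dq - Dp)); last first.
  rewrite /slope_sum -/eta -[in RHS]mulrBr -[in RHS]sumrB [RHS]mulrAC -/K [RHS]mulr_sumr.
  apply: eq_bigr => a _; rewrite /= !expr0 !expr1.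
  have -> : 0 * x + (p + a%:R * eta) + 0 = p + a%:R * eta by ring.
  have -> : 0 * x + (p + a%:R * eta) + (q - p) = q + a%:R * eta by ring.
  have -> : eps * x + (p + a%:R * eta) + 0 = p + eps * x + a%:R * eta by ring.
  have -> : eps * x + (p + a%:R * eta) + (q - p) = q + eps * x + a%:R * eta by ring.
  by ring.
have -> : (slope_sum h eps N q x - slope_sum h eps N p x) / (Dq - Dp) - x =
  ((slope_sum h eps N q x - Dq * x) - (slope_sum h eps N p x - Dp * x)) / (Dq - Dp).
  by field.
rewrite normrM normfV ler_pdivrMr ?normr_gt0 //.
by apply: le_trans (ler_normB _ _) _; lra.
Qed.

End Gate.

(** * Orbits of multi-indices and Bell numbers *)

Section Words.
Variable T : eqType.
Implicit Types s : seq T.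

(* Letters are numbered by order of first appearance when [s] is read from
   right to left, so that the numbering is stable under [cons]. *)
Definition pattern s : seq nat := [seq index x (rev (undup s)) | x <- s].

Lemma pattern_cons x s : pattern (x :: s) = index x (rev (undup s)) :: pattern s.
Proof.
rewrite /pattern /=; case: ifP => [//|xs].
rewrite rev_cons -cats1 index_cat mem_rev mem_undup xs /= eqxx addn0.
congr cons; first by rewrite memNindex // mem_rev mem_undup xs.
by apply/eq_in_map => y ys; rewrite index_cat mem_rev mem_undup ys.
Qed.
End Words.

(** The recursion of [stirling2]: a prepended letter repeats one of the labels in use or takes the
    next free one. *)
Fixpoint patterns (l j : nat) : seq (seq nat) :=
  match l, j with
  | 0, 0 => [:: [::]]
  | 0, _.+1 => [::]
  | _.+1, 0 => [::]
  | l'.+1, j'.+1 => [seq a :: c | a <- iota 0 j'.+1, c <- patterns l' j'.+1]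
                    ++ [seq j' :: c | c <- patterns l' j']
  end.

Lemma size_patterns l j : size (patterns l j) = stirling2 l j.
Proof.
elim: l j => [|l IH] [|j] //=.
by rewrite size_cat -/(allpairs _ _ _) !size_map !size_cat size_allpairs !size_map size_iota !IH mulSn.
Qed.

Lemma pattern_in_patterns (T : eqType) (s : seq T) :
  pattern s \in patterns (size s) (size (undup s)).
Proof.
elim: s => [//|x s IH].
rewrite pattern_cons -[size (x :: s)]/(size s).+1.
rewrite -[undup (x :: s)]/(if x \in s then undup s else x :: undup s).
case: ifP => xs.
  have xu : x \in rev (undup s) by rewrite mem_rev mem_undup.
  have := xu; rewrite -index_mem size_rev.
  case: (size (undup s)) IH => [//|j] IH xj.
  rewrite /patterns -/patterns mem_cat; apply/orP; left.
  by apply: allpairs_f => //; rewrite mem_iota.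
rewrite -[size (x :: _)]/(size (undup s)).+1 /patterns -/patterns mem_cat; apply/orP; right.
rewrite memNindex ?mem_rev ?mem_undup ?xs // size_rev.
by apply: map_f.
Qed.

Section Classes.
Variables n l : nat.
Implicit Types i j : idx n l.

Definition word i : seq 'I_n := [seq i t | t <- enum 'I_l].

Lemma word_nth i (t : 'I_l) x0 : nth x0 (word i) t = i t.
Proof. by rewrite (nth_map t) ?size_enum_ord // nth_ord_enum. Qed.

Lemma size_word i : size (word i) = l.
Proof. by rewrite size_map size_enum_ord. Qed.

Lemma eqclassP i j : reflect (exists pi, j = act_idx pi i) (j \in eqclass i).
Proof.
rewrite inE; apply: (iffP existsP) => -[pi]; last by move=> ->; exists pi.
by move/eqP=> ->; exists pi.
Qed.

Lemma act_idxM (pi rho : {perm 'I_n}) i :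
  act_idx rho (act_idx pi i) = act_idx (pi * rho)%g i.
Proof. by apply/ffunP => t; rewrite !ffunE permM. Qed.

Lemma act_idxK (pi : {perm 'I_n}) : cancel (@act_idx n l pi) (act_idx pi^-1%g).
Proof. by move=> i; apply/ffunP => t; rewrite !ffunE permK. Qed.

Lemma act_idx1 i : act_idx 1%g i = i.
Proof. by apply/ffunP => t; rewrite !ffunE perm1. Qed.

Lemma eqclass_refl i : i \in eqclass i.
Proof. by apply/eqclassP; exists 1%g; rewrite act_idx1. Qed.

Lemma eqclass_eq i j : j \in eqclass i -> eqclass j = eqclass i.
Proof.
case/eqclassP => pi ->; apply/setP => m.
apply/eqclassP/eqclassP => -[rho ->].
  by exists (pi * rho)%g; rewrite act_idxM.
by exists (pi^-1 * rho)%g; rewrite act_idxM mulgA mulgV mul1g.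
Qed.

(** Each word's letters, in the order in which [pattern] numbers them, are completed to an
    enumeration of [n]; matching the two enumerations position by position is the required
    permutation. *)
Lemma pattern_eqclass i j : pattern (word i) = pattern (word j) -> j \in eqclass i.
Proof.
move=> pij.
pose D m := rev (undup (word m)).
pose full m := D m ++ [seq x <- enum 'I_n | x \notin D m].
have uD m : uniq (D m) by rewrite rev_uniq undup_uniq.
have ufull m : uniq (full m).
  rewrite cat_uniq uD filter_uniq ?enum_uniq // andbT.
  by apply/hasPn => x; rewrite mem_filter => /andP[].
have memfull m x : x \in full m.
  by rewrite mem_cat mem_filter mem_enum andbT orbN.
have sizefull m : size (full m) = n.
  have /perm_size -> : perm_eq (full m) (enum 'I_n).
    by apply: uniq_perm; rewrite ?enum_uniq // => x; rewrite memfull mem_enum.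
  by rewrite size_enum_ord.
pose f x := nth x (full j) (index x (full i)).
have f_inj : injective f.
  have idx_lt x : (index x (full i) < n)%N 
    by have := memfull i x; rewrite -index_mem sizefull.
  move=> x y; rewrite /f (set_nth_default y) ?sizefull //.
  move/eqP; rewrite nth_uniq ?sizefull //.
  by move/eqP/(congr1 (nth x (full i))); rewrite !nth_index.
apply/eqclassP; exists (perm f_inj); apply/ffunP => t; rewrite ffunE permE /f.
have memD (m : idx n l) : m t \in D m by rewrite mem_rev mem_undup map_f ?mem_enum.
have indexD (m : idx n l) : index (m t) (full m) = nth 0%N (pattern (word m)) t.
  rewrite index_cat memD (nth_map (m t)) ?size_word // word_nth //.
by rewrite indexD pij -indexD nth_index.
Qed.

(** Membership, the number of distinct letters and the label of a letter are all computed by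
    recursion from equality tests alone, so equal tests give equal patterns. *)
Lemma kernel_eqclass i j :
  (forall s t, (i s == i t) = (j s == j t)) -> j \in eqclass i.
Proof.
move=> ker; apply: pattern_eqclass.
have memE u t : (i t \in map i u) = (j t \in map j u).
  by elim: u => //= a u IH; rewrite !inE ker IH.
have sizeE u : size (undup (map i u)) = size (undup (map j u)).
  by elim: u => //= a u IH; rewrite memE; case: ifP => //= _; rewrite IH.
have indexE u t : index (i t) (rev (undup (map i u))) =
                  index (j t) (rev (undup (map j u))).
  elim: u => //= a u IH; rewrite memE; case: ifP => // _.
  rewrite !rev_cons -!cats1 !index_cat !mem_rev !mem_undup memE IH /=.
  by rewrite !size_rev sizeE ker.
by rewrite /pattern /word -!map_comp; apply: eq_map => t /=.
Qed.

(** The pattern of a chosen member is an injective code of a class, with values in a list of length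
    [bell l]. *)
Lemma card_classes_le_bell : (#|Defs.classes n l| <= bell l)%N.
Proof.
pose all := flatten [seq patterns l m | m <- iota 0 l.+1].
have -> : bell l = size all.
  rewrite size_flatten /shape -map_comp sumnE big_map /bell.
  rewrite -(big_mkord xpredT (stirling2 l)) /index_iota subn0.
  by apply: eq_bigr => m _ /=; rewrite size_patterns.
have memall i : pattern (word i) \in all.
  apply/flattenP; exists (patterns l (size (undup (word i)))).
    apply: map_f; rewrite mem_iota add0n /= ltnS.
    by rewrite -[leqRHS](size_word i) size_undup.
  by rewrite -[X in patterns X](size_word i) pattern_in_patterns.
pose code (g : {set idx n l}) : seq nat :=
  if [pick i in g] is Some i then pattern (word i) else [::].
have codeP g : g \in Defs.classes n l -> exists2 i, g = eqclass i & code g = pattern (word i).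
  case/imsetP => i _ ->; rewrite /code; case: pickP => [m mi|/(_ i)].
    by exists m => //; rewrite (eqclass_eq mi).
  by rewrite eqclass_refl.
rewrite cardE -(size_map code); apply: uniq_leq_size.
  rewrite map_inj_in_uniq ?enum_uniq // => g g'; rewrite !mem_enum.
  move=> /codeP[i -> ->] /codeP[j -> ->] /pattern_eqclass ij.
  by rewrite (eqclass_eq ij).
move=> c /mapP[g]; rewrite mem_enum => /codeP[i _ ->] ->; exact: memall.
Qed.

End Classes.

(** * Sharp attention and fibers of a class *)

(** Relative to the top score [T * M], the weights are 1 on [S] and at most [expR (- T)] elsewhere,
    so the denominator exceeds [#|S|] by at most [#|I| * expR (- T)]. *)
Lemma softmax_argmax (R : realType) (I : finType) (s : I -> R) (T M : R) (S : {set I}) :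
  (0 < #|S|)%N ->
  (forall j, j \in S -> s j = T * M) ->
  (forall j, j \notin S -> s j <= T * (M - 1)) ->
  forall j, `|#|S|%:R * (expR (s j) / \sum_j' expR (s j')) - (j \in S)%:R|
     <= #|I|%:R * expR (- T).
Proof.
move=> S0 sS sNS j.
pose v j := expR (s j - T * M).
have vE i : expR (s i) = v i * expR (T * M) by rewrite /v -expRD subrK.
under eq_bigr do rewrite vE.
rewrite vE -mulr_suml -mulf_div divff ?gt_eqF ?expR_gt0 // mulr1.
have v0 i : 0 <= v i by exact: expR_ge0.
have vS i : i \in S -> v i = 1 by move=> iS; rewrite /v sS // subrr expR0.
have vNS i : i \notin S -> v i <= expR (- T).
  by move=> /sNS si; rewrite /v ler_expR; lra.
pose rho := \sum_(i in ~: S) v i.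
have sumE : \sum_i v i = #|S|%:R + rho.
  rewrite (bigID [in S]) /= (eq_bigr (fun=> 1)); last by move=> i; exact: vS.
  rewrite sumr_const; congr (_ + _).
  by apply: eq_bigl => i; rewrite inE.
have rho0 : 0 <= rho by apply: sumr_ge0.
have I0 : 1 <= #|I|%:R :> R by rewrite ler1n (leq_trans S0) // max_card.
have T0 := expR_gt0 (- T).
have rhoT : rho <= #|I|%:R * expR (- T).
  apply: (@le_trans _ _ (#|~: S|%:R * expR (- T))).
    by rewrite mulr_natl -sumr_const; apply: ler_sum => i; rewrite inE => /vNS.
  by rewrite ler_wpM2r ?ler_nat ?max_card // ltW.
have c1 : 1 <= #|S|%:R :> R by rewrite ler1n.
set c : R := #|S|%:R in c1 sumE *.
have cr : 0 < c + rho by lra.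
rewrite sumE; case: (boolP (j \in S)) => jS.
  rewrite vS // mul1r; have -> : c / (c + rho) - 1%:R = - (rho / (c + rho)).
    by field; rewrite gt_eqF.
  rewrite normrN ger0_norm; last by rewrite divr_ge0 // ltW.
  apply: le_trans rhoT; rewrite ler_pdivrMr //.
  by rewrite ler_peMr //; lra.
rewrite subr0 ger0_norm; last first.
  by rewrite mulr_ge0 ?divr_ge0 //; lra.
have vT := vNS _ jS.
apply: (@le_trans _ _ (v j)).
  by rewrite mulrA ler_pdivrMr // mulrC ler_wpM2l //; lra.
apply: le_trans vT _; rewrite ler_peMl //; exact: ltW.
Qed.

Section Fibers.
Variables n k : nat.
Implicit Types i j p q : idx n k.

Definition lidx (x : idx n (k + k)) : idx n k := [ffun t => x (lshift k t)].
Definition ridx (x : idx n (k + k)) : idx n k := [ffun t => x (rshift k t)].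

Lemma cat_lridx x : cat_idx (lidx x) (ridx x) = x.
Proof.
apply/ffunP => t; rewrite ffunE -[in RHS](splitK t).
by case: (fintype.split t) => a; rewrite ffunE.
Qed.

Lemma act_cat_idx pi i j :
  act_idx pi (cat_idx i j) = cat_idx (act_idx pi i) (act_idx pi j).
Proof. by apply/ffunP => t; rewrite !ffunE; case: (fintype.split t) => a; rewrite !ffunE. Qed.

Lemma cat_idx_inj i j p q : cat_idx i j = cat_idx p q -> i = p /\ j = q.
Proof.
move/ffunP => e; split; apply/ffunP => t.
  by have := e (lshift k t); rewrite !ffunE (unsplitK (inl t)).
by have := e (rshift k t); rewrite !ffunE (unsplitK (inr t)).
Qed.

Lemma cat_eqclass i j p q : cat_idx i j \in eqclass (cat_idx p q) ->
  i \in eqclass p /\ j \in eqclass q.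
Proof.
case/eqclassP => pi; rewrite act_cat_idx => /cat_idx_inj[-> ->].
by split; apply/eqclassP; exists pi.
Qed.

(** Equalities inside [j] count as one condition on its class, which the key reads off the type
    identifier; only equalities between [i] and [j] need positional codes. *)
Definition mismatch p q i j : nat :=
  (\sum_a \sum_b ((i a == j b) != (p a == q b)) + (eqclass j != eqclass q))%N.

Lemma act_idx_eq l (pi : {perm 'I_n}) (x : idx n l) s t :
  (act_idx pi x s == act_idx pi x t) = (x s == x t).
Proof. by rewrite !ffunE (inj_eq perm_inj). Qed.

(** The equality tests on a concatenation form four blocks: the classes of [i] and [j] settle the
    diagonal ones and the cross conditions settle the others, so [kernel_eqclass] applies. *)
Lemma mismatch_eq0 p q i j : i \in eqclass p ->
  (mismatch p q i j == 0)%N = (cat_idx i j \in eqclass (cat_idx p q)).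
Proof.
move=> ip; apply/idP/idP.
  rewrite addn_eq0 eqb0 negbK => /andP[sum0 /eqP jq].
  have {}jq : j \in eqclass q by rewrite -jq eqclass_refl.
  have cross a b : (i a == j b) = (p a == q b).
    move: sum0; rewrite sum_nat_eq0 => /forallP/(_ a); rewrite sum_nat_eq0.
    by move/forallP/(_ b); rewrite eqb0 negbK => /eqP.
  apply: kernel_eqclass => s t.
  case/eqclassP: ip => pi ip; case/eqclassP: jq => rho jq.
  rewrite !ffunE; case: (fintype.split s) => a; case: (fintype.split t) => b.
  - by rewrite ip act_idx_eq.
  - by rewrite cross.
  - by rewrite [j a == _]eq_sym [q a == _]eq_sym cross.
  - by rewrite jq act_idx_eq.
case/eqclassP => pi; rewrite act_cat_idx => /cat_idx_inj[-> jq].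
have jq' : j \in eqclass q by apply/eqclassP; exists pi.
rewrite /mismatch (eqclass_eq jq') eqxx addn0 big1 // => a _.
by rewrite big1 // => b _; rewrite jq !ffunE (inj_eq perm_inj) eqxx.
Qed.

(** A permutation taking [p] to [i] maps one fiber onto the other. Hence a single factor in the
    value weight undoes the softmax normalization for every query in the class. *)
Lemma card_fiber p i (x : idx n (k + k)) : i \in eqclass p ->
  #|[set j | cat_idx i j \in eqclass x]| = #|[set j | cat_idx p j \in eqclass x]|.
Proof.
case/eqclassP => pi ->.
rewrite -[RHS](card_imset _ (can_inj (@act_idxK n k pi))); apply: eq_card => j.
have stable y : (act_idx pi y \in eqclass x) = (y \in eqclass x).
  apply/eqclassP/eqclassP => -[rho].
    by move/(congr1 (act_idx pi^-1%g)); rewrite act_idxK act_idxM => ->; eexists.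
  by move=> ->; rewrite act_idxM; eexists.
rewrite inE; apply/idP/imsetP => [pj|[m]].
  exists (act_idx pi^-1%g j).
    by rewrite inE -stable act_cat_idx act_idxM mulVg act_idx1.
  by rewrite act_idxM mulVg act_idx1.
by rewrite inE => pm ->; rewrite -act_cat_idx stable.
Qed.

(** For bits, [u != v] equals [v - (-1) ^+ (~~ v) * u], which is affine in [u]; the left-hand side
    is what queries and keys can compute. *)
Lemma score_mismatch (R : realType) p q i j :
  \sum_a \sum_b ((-1) ^+ (p a != q b) * (i a == j b)%:R) + (eqclass j == eqclass q)%:R
  = \sum_a \sum_b (p a == q b)%:R + 1 - (mismatch p q i j)%:R :> R.
Proof.
rewrite /mismatch natrD natr_sum opprD addrACA -sumrB; congr (_ + _).
  apply: eq_bigr => a _; rewrite natr_sum -sumrB; apply: eq_bigr => b _.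
  by case: (p a == q b); case: (i a == j b); rewrite /= ?expr0 ?expr1; ring.
by case: (_ == _) => /=; ring.
Qed.

End Fibers.

(** * The transformer layer *)

Lemma mxvec_dot (R : realType) m n (A B : 'M[R]_(m, n)) :
  (mxvec A *m (mxvec B)^T) 0 0 = \sum_a \sum_c A a c * B a c.
Proof.
rewrite mxE (reindex _ (curry_mxvec_bij m n)) /= pair_bigA /=.
by apply: eq_bigr => -[a c] _; rewrite mxE !mxvecE.
Qed.

Lemma delta_row_dot (R : realType) m (x y : 'I_m) :
  ((delta_mx 0 x : 'rV[R]_m) *m (delta_mx 0 y : 'rV[R]_m)^T) 0 0 = (x == y)%:R.
Proof. by rewrite trmx_delta mul_delta_mx_cond mulmxnE mxE !eqxx. Qed.

Lemma sum_enum_triple (R : realType) (I J K : finType) (F : I * J * K -> R) :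
  \sum_(t < #|{: I * J * K}|) F (enum_val t) = \sum_i \sum_j \sum_q F (i, j, q).
Proof.
rewrite -(big_enum_val F) pair_bigA pair_bigA.
by apply: eq_big => [x|[[i j] q]].
Qed.

Section Construction.
Variables (R : realType) (sigma : R -> R) (n k d dp H : nat).
Variables (P : 'M[R]_(n, dp)) (bias : {set idx n k} -> 'rV[R]_d).
Variables (pat : 'I_H -> idx n (k + k)) (wval : 'I_H -> 'M[R]_d) (T : R).
Variables (Q : finType) (gc ga gb ge : Q -> R).
Hypothesis P_orthonormal : P *m P^T = 1%:M.

Notation de := #|{: {set idx n k}}|.
Notation din := (d + k * dp + de)%N.
Notation dT := (d + (din + H * d))%N.
Notation dH := (k * dp + de)%N.

Definition class_code (g : {set idx n k}) : 'rV[R]_de := delta_mx 0 (enum_rank g).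

Definition pos_code (i : idx n k) : 'rV[R]_(k * dp) :=
  mxvec (\matrix_(a < k, c < dp) P (i a) c).

(* A token is laid out as [bias | augmented input | one slot of width d per head]. *)
Definition embed_in : 'M[R]_(din, dT) :=
  row_mx (col_mx 0 (\matrix_(g < de, c < d) bias (enum_val g) 0 c))
         (row_mx 1%:M 0).

Definition token X i : 'rV[R]_dT := augment P class_code X i *m embed_in.

Lemma tokenE X i : token X i =
  row_mx (bias (eqclass i)) (row_mx (augment P class_code X i) 0).
Proof.
rewrite /token /embed_in mul_mx_row; congr row_mx; last first.
  by rewrite mul_mx_row mulmx1 mulmx0.
(* The one-hot type identifier selects the bias of its class, which the residual connections then
   carry to the output. *)
rewrite /augment mul_row_col mulmx0 add0r; apply/rowP => c.
rewrite /class_code -rowE !mxE enum_rankK //.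
Qed.

(** The signs of [score_mismatch]. Rows are indexed by key positions, so that the product with the
    query's positional rows has in row [b] what must be paired with row [b] of the key. *)
Definition sign_pattern (h : 'I_H) : 'M[R]_k :=
  \matrix_(b, a) (-1) ^+ (lidx (pat h) a != ridx (pat h) b).

(* Attention scores are divided by [sqrt dH]; [gain] compensates for it. *)
Definition gain : R := T * Num.sqrt dH%:R.

(** The condition on the class of the key does not depend on the query token, so its target sits in
    the query bias. The output matrix writes into row [h] of a flattened [H] by [d] matrix, which
    keeps the heads apart. *)
Definition head (h : 'I_H) : attn_head R dT dH d := Head
  (col_mx 0 (col_mx (col_mx (col_mx 0
     (row_mx (lin_mx (mulmx (gain *: sign_pattern h))) 0)) 0) 0))
  (row_mx 0 (gain *: class_code (eqclass (ridx (pat h)))))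
  (col_mx 0 (col_mx (col_mx (col_mx 0 (row_mx 1%:M 0)) (row_mx 0 1%:M)) 0))
  0
  (col_mx 0 (col_mx (col_mx (col_mx (wval h) 0) 0) 0))
  (row_mx 0 (row_mx 0 (lin1_mx (mxvec \o mulmx (delta_mx h (0 : 'I_1)))))).

Lemma queryE h X i : token X i *m wQ (head h) + bQ (head h) =
  row_mx (mxvec (gain *: sign_pattern h *m (\matrix_(a < k, c < dp) P (i a) c)))
         (gain *: class_code (eqclass (ridx (pat h)))).
Proof.
rewrite tokenE /augment /= !mul_row_col !(mulmx0, addr0, add0r).
by rewrite mul_mx_row mulmx0 mul_vec_lin add_row_mx addr0 add0r.
Qed.

Lemma keyE h X j : token X j *m wK (head h) + bK (head h) =
  row_mx (pos_code j) (class_code (eqclass j)).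
Proof.
rewrite tokenE /augment /= !mul_row_col !(mulmx0, addr0, add0r).
by rewrite !mul_mx_row !mulmx0 !mulmx1 add_row_mx addr0 add0r.
Qed.

Lemma valueE h X j : token X j *m wV (head h) = X j *m wval h.
Proof.
by rewrite tokenE /augment /= !mul_row_col !(mulmx0, addr0, add0r).
Qed.

Lemma row_dot (i j : 'I_n) : \sum_c P i c * P j c = (i == j)%:R.
Proof.
have := congr1 (fun A : 'M[R]_n => A i j) P_orthonormal; rewrite !mxE => <-.
by apply: eq_bigr => c _; rewrite mxE.
Qed.

(** Once the sums are exchanged, the positional rows enter only through their dot products, which
    orthonormality turns into equality tests. *)
Lemma pos_score h (i j : idx n k) :
  (mxvec (gain *: sign_pattern h *m (\matrix_(a < k, c < dp) P (i a) c))
    *m (pos_code j)^T) 0 0 =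
  gain * \sum_a \sum_b
    ((-1) ^+ (lidx (pat h) a != ridx (pat h) b) * (i a == j b)%:R).
Proof.
rewrite mxvec_dot exchange_big /= mulr_sumr.
under eq_bigr => c _ do under eq_bigr => b _ do
  rewrite -scalemxAl !mxE -mulrA mulr_suml.
rewrite exchange_big /=.
under eq_bigr => b _ do rewrite -mulr_sumr exchange_big mulr_sumr /=.
rewrite exchange_big /=; apply: eq_bigr => a _.
rewrite mulr_sumr; apply: eq_bigr => b _; congr (_ * _).
rewrite -row_dot mulr_sumr; apply: eq_bigr => c _.
by rewrite !mxE mulrA.
Qed.

Lemma attn_scoreE h X (i j : idx n k) : (0 < dH)%N ->
  attn_score (head h) (token X) i j =
  T * (\sum_a \sum_b
       ((-1) ^+ (lidx (pat h) a != ridx (pat h) b) * (i a == j b)%:R)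
       + (eqclass j == eqclass (ridx (pat h)))%:R).
Proof.
move=> dH0; rewrite /attn_score queryE keyE tr_row_mx mul_row_col mxE pos_score.
rewrite -scalemxAl mxE delta_row_dot (inj_eq enum_rank_inj) eq_sym -mulrDr.
rewrite /gain mulrAC mulfK // gt_eqF // sqrtr_gt0 ltr0n //.
Qed.

Definition head_output X i (h : 'I_H) : 'rV[R]_d :=
  \sum_j attn (head h) (token X) i j *: (X j *m wval h).

Lemma msaE X i : msa head (token X) i =
  row_mx 0 (row_mx 0 (mxvec (\matrix_h head_output X i h))).
Proof.
rewrite /msa.
transitivity (\sum_h row_mx (0 : 'rV[R]_d) (row_mx (0 : 'rV[R]_din)
    (mxvec (delta_mx h (0 : 'I_1) *m head_output X i h)))).
  apply: eq_bigr => h _; under eq_bigr => j _ do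
    rewrite valueE scalemxAl.
  rewrite -mulmx_suml -/(head_output X i h) /= !mul_mx_row !mulmx0.
  by rewrite mul_rV_lin1.
have -> : \matrix_h head_output X i h =
    \sum_h delta_mx h (0 : 'I_1) *m head_output X i h.
  apply/row_matrixP => h; rewrite rowK linear_sum (bigD1 h) //=.
  rewrite row_mul big1 => [|h' h'h]; last first.
    apply/rowP => c; rewrite !mxE big1 // => z _.
    by rewrite !mxE eq_sym (negbTE h'h) mul0r.
  rewrite addr0; apply/rowP => c.
  by rewrite !mxE big_ord1 !mxE !eqxx mul1r.
rewrite linear_sum /=.
elim/big_rec2: _ => [|h u v _ ->]; first by rewrite !row_mx0.
by rewrite !add_row_mx !addr0.
Qed.

Notation neuron := ('I_H * 'I_d * Q)%type.
Notation width := #|{: neuron}|.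

(** Neuron [(h, c, q)] is neuron [q] of a gate for coordinate [c] of head [h]. The gate bit is read
    off the one-hot type identifier, and the gates of all heads are added up in output coordinate
    [c]. *)
Definition gating_mlp : mlp R dT width := MLP
  (col_mx 0 (col_mx
    (col_mx 0 (\matrix_(g < de, t < width)
       let: (h, c, q) := enum_val t in
       ge q * (enum_val g == eqclass (lidx (pat h)))%:R))
    (\matrix_(s < H * d, t < width)
       let: (h, c, q) := enum_val t in ga q * mxvec (delta_mx h c) 0 s)))
  (\row_t gb (enum_val t).2)
  (row_mx (\matrix_(t < width, c < d)
     (gc (enum_val t).2 * (c == (enum_val t).1.2)%:R)) 0)
  0.

Lemma transformerE X i (c : 'I_d) :
  lsubmx (transformer sigma head gating_mlp (token X) i) 0 c =
  bias (eqclass i) 0 c + \sum_h \sum_q gc q *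
    sigma (ga q * head_output X i h 0 c + gb q
           + ge q * (eqclass i == eqclass (lidx (pat h)))%:R).
Proof.
rewrite /transformer msaE tokenE !add_row_mx !addr0 add0r.
set U := \matrix_h head_output X i h.
set z := row_mx _ _; rewrite /mlp_apply addr0 mul_mx_row mulmx0.
rewrite /z add_row_mx row_mxKl -/z mxE; congr (_ + _).
pose F (t : neuron) := gc t.2 * (c == t.1.2)%:R *
  sigma (ga t.2 * head_output X i t.1.1 0 t.1.2 + gb t.2
           + ge t.2 * (eqclass i == eqclass (lidx (pat t.1.1)))%:R).
transitivity (\sum_(t < width) F (enum_val t)); last first.
  rewrite sum_enum_triple; apply: eq_bigr => h _.
  rewrite (bigD1 c) //= [X in _ + X]big1 ?addr0; last first.
    move=> c' c'c; apply: big1 => q _.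
    by rewrite /F /= eq_sym (negbTE c'c) mulr0 mul0r.
  by apply: eq_bigr => q _; rewrite /F /= eqxx mulr1.
rewrite mxE; apply: eq_bigr => t _.
rewrite [X in _ * X]mxE /F mulrC; congr (_ * _).
rewrite mxE; congr sigma; rewrite mxE [X in _ + X]mxE [RHS]addrAC.
case tE : (enum_val t) => [[h c'] q] /=; congr (_ + _).
rewrite /z !mul_row_col mulmx0 add0r mxE addrC.
congr (_ + _).
  have -> : head_output X i h 0 c' = U h c' by rewrite /U mxE.
  have -> : U h c' = (mxvec U *m (mxvec (delta_mx h c'))^T) 0 0.
    rewrite mxvec_dot (bigD1 h) //= (bigD1 c') //= [delta_mx _ _ _ _]mxE !eqxx mulr1.
    rewrite [X in _ + X + _]big1 ?[X in _ + X]big1 ?addr0 // => [a ah|b bc'].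
      by apply: big1 => b _; rewrite [delta_mx _ _ _ _]mxE (negbTE ah) mulr0.
    by rewrite [delta_mx _ _ _ _]mxE (negbTE bc') andbF mulr0.
  rewrite !mxE mulr_sumr; apply: eq_bigr => s _.
  by rewrite !mxE tE mulrCA.
rewrite mulmx0 add0r /class_code -rowE !mxE.
by rewrite tE enum_rankK.
Qed.

End Construction.

(** * Approximation error *)

(** Each coordinate is continuous for the product topology, hence bounded on [K]; the finitely many
    bounds are added, plus 1 for positivity. *)
Lemma compact_coord_bounded (R : realType) (I : finType) (d : nat)
  (K : set {ptws I -> 'rV[R]_d}) : compact K ->
  exists2 B : R, 0 < B &
    forall X : I -> 'rV[R]_d, K X -> forall i c, `|X i 0 c| <= B.
Proof.
move=> cK.
have bnd (ic : I * 'I_d) : exists B : R,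
    forall X : I -> 'rV[R]_d, K X -> `|X ic.1 0 ic.2| <= B.
  case: ic => i c /=.
  pose f (X : {ptws I -> 'rV[R]_d}) : R := X i 0 c.
  have fc : continuous f.
    move=> X; apply: (@continuous_comp _ _ _ (fun X : {ptws I -> 'rV[R]_d} => X i)
       (fun M : 'rV[R]_d => M 0 c)).
      exact: (@proj_continuous I (fun=> 'rV[R]_d) i).
    exact: coord_continuous.
  have /compact_bounded/pinfty_ex_gt0[M _ HM] : compact (f @` K)%classic.
    apply: continuous_compact => //; exact: continuous_subspaceT.
  by exists M => X KX; apply: HM; exists X.
have [B HB] := choice bnd.
exists (1 + \sum_ic `|B ic|); first by rewrite ltr_pwDl ?sumr_ge0.
move=> X KX i c; apply: le_trans (HB (i, c) X KX) _.
rewrite (bigD1 (i, c)) //=; apply: le_trans (ler_norm _) _.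
by rewrite addrCA lerDl addr_ge0 ?sumr_ge0.
Qed.

Lemma eucl_dist_le (R : realType) (d : nat) (u v : 'rV[R]_d) (eta : R) :
  0 <= eta -> (forall c, `|u 0 c - v 0 c| <= eta) -> eucl_dist u v <= d%:R * eta.
Proof.
move=> eta0 uv; rewrite /eucl_dist -[leRHS]ger0_norm ?mulr_ge0 //.
rewrite -sqrtr_sqr ler_sqrt ?sqr_ge0 //.
apply: (@le_trans _ _ (d%:R * eta ^+ 2)).
  rewrite -[X in X%:R * _](card_ord d) mulr_natl -sumr_const; apply: ler_sum => c _.
  by rewrite -[leLHS]real_normK ?num_real // lerXn2r ?nnegrE.
rewrite exprMn ler_wpM2r ?sqr_ge0 //.
case: d {u v uv} => [|d]; first by rewrite expr2 mulr0.
by rewrite expr2 ler_peMl // ler1n.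
Qed.

(** Indices past the enumeration contribute [F x0 = 0]; this matches the [bell (2 * k)] heads with
    the classes, which may be fewer when [n] is small. *)
Lemma sum_nth_padded (R : realType) (T : finType) (S : {set T}) (F : T -> R)
  (x0 : T) (H : nat) : (#|S| <= H)%N -> F x0 = 0 ->
  \sum_(h < H) F (nth x0 (enum S) h) = \sum_(x in S) F x.
Proof.
move=> SH F0.
rewrite -(big_mkord xpredT (fun h => F (nth x0 (enum S) h))).
rewrite (@big_cat_nat _ _ _ (size (enum S))) //= -?cardE //.
rewrite [X in _ + X]big1_seq ?addr0 => [|h]; last first.
  by rewrite mem_index_iota => /andP[_ /andP[Sh _]]; rewrite nth_default -?cardE.
by rewrite -[RHS]big_enum [RHS](big_nth x0) cardE.
Qed.

Lemma attn_itv (R : realType) (I : finType) dT dH dv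
  (h : attn_head R dT dH dv) (Z : I -> 'rV[R]_dT) i j :
  0 <= attn h Z i j <= 1.
Proof.
rewrite /attn; have s0 : 0 < \sum_j' expR (attn_score h Z i j').
  rewrite (bigD1 j) //= ltr_pwDl ?expR_gt0 //.
  by apply: sumr_ge0 => *; exact: expR_ge0.
apply/andP; split; first by rewrite divr_ge0 ?expR_ge0 // ltW.
rewrite ler_pdivrMr // mul1r.
rewrite (bigD1 j) //= lerDl.
by apply: sumr_ge0 => *; exact: expR_ge0.
Qed.

Lemma eq_layerE (R : realType) (n k d : nat)
  (w : {set idx n (k + k)} -> 'M[R]_(d, d)) (b : {set idx n k} -> 'rV[R]_d)
  (X : idx n k -> 'rV[R]_d) (i : idx n k) (c : 'I_d) :
  eq_layer w b X i 0 c = b (eqclass i) 0 c +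
  \sum_(mu in Defs.classes n (k + k)) \sum_j (cat_idx i j \in mu)%:R * (X j *m w mu) 0 c.
Proof.
rewrite /eq_layer mxE addrC; congr (_ + _).
  rewrite (bigD1 (eqclass i)) /=; last by apply: imset_f.
  rewrite big1 ?addr0 => [|lam /andP[/imsetP[p _ ->] ne]].
    by rewrite /basis_tensor eqclass_refl scale1r.
  rewrite /basis_tensor; case: (boolP (i \in eqclass p)) => [/eqclass_eq ip|_].
    by rewrite ip eqxx in ne.
  by rewrite scale0r.
rewrite summxE; apply: eq_bigr => mu _; rewrite summxE; apply: eq_bigr => j _.
by rewrite mxE.
Qed.

Section HeadError.
Variables (R : realType) (n k d dp H : nat).
Variables (P : 'M[R]_(n, dp)) (bias : {set idx n k} -> 'rV[R]_d).
Variables (pat : 'I_H -> idx n (k + k)) (wval : 'I_H -> 'M[R]_d) (T : R).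
Hypotheses (P_orthonormal : P *m P^T = 1%:M) (T_ge0 : 0 <= T).

Notation tok := (@token R n k d dp H P bias).
Notation hd := (@head R n k d dp H pat wval T).
Let fiber h (i : idx n k) := [set j | cat_idx i j \in eqclass (pat h)].

(** Keys in the fiber attain the top score [T * M], and every violated condition costs [T], so
    [softmax_argmax] applies to the fiber over [i], which has the same size as the one over
    [lidx (pat h)]. *)
Lemma attn_fiber h X (i j : idx n k) : i \in eqclass (lidx (pat h)) ->
  `|#|fiber h (lidx (pat h))|%:R * attn (hd h) (tok X) i j
    - (cat_idx i j \in eqclass (pat h))%:R| <= #|idx n k|%:R * expR (- T).
Proof.
move=> ip; set p := lidx (pat h); set q := ridx (pat h).
have dH0 : (0 < k * dp + #|{: {set idx n k}}|)%N.
  by rewrite addn_gt0; apply/orP; right; apply/card_gt0P; exists finset.set0.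
have -> : (cat_idx i j \in eqclass (pat h)) = (j \in fiber h i) by rewrite /fiber [RHS]inE.
rewrite -(card_fiber (pat h) ip) -/(fiber h i).
pose M : R := \sum_a \sum_b (p a == q b)%:R + 1.
have scoreE m : attn_score (hd h) (tok X) i m = T * (M - (mismatch p q i m)%:R).
  by rewrite attn_scoreE // score_mismatch.
have fiberE m : (m \in fiber h i) = (mismatch p q i m == 0%N).
  by rewrite /fiber [LHS]inE mismatch_eq0 // cat_lridx.
have S0 : (0 < #|fiber h i|)%N.
  rewrite /fiber (card_fiber (pat h) ip); apply/card_gt0P; exists q.
  by rewrite inE cat_lridx eqclass_refl.
apply: (softmax_argmax S0 (M := M)) => m; rewrite fiberE scoreE.
  by move/eqP=> ->; rewrite subr0.
rewrite -lt0n => m0; rewrite ler_wpM2l // lerB // ler1n //.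
Qed.

(** Attention weights lie in [0, 1]. The bound gives the range on which the gate has to be
    accurate. *)
Lemma head_output_bound h X (i : idx n k) (c : 'I_d) (B : R) :
  (forall j, `|(X j *m wval h) 0 c| <= B) ->
  `|head_output P bias pat wval T X i h 0 c| <= #|idx n k|%:R * B.
Proof.
move=> XB; rewrite /head_output summxE; apply: normr_sum_le => j.
rewrite mxE normrM; have /andP[a0 a1] := attn_itv (hd h) (tok X) i j.
by rewrite (ger0_norm a0); apply: le_trans (ler_piMl _ a1) (XB j).
Qed.

Lemma head_output_error h X (i : idx n k) (c : 'I_d) (W : 'M[R]_d) (B : R) :
  i \in eqclass (lidx (pat h)) ->
  wval h = #|fiber h (lidx (pat h))|%:R *: W ->
  (forall j, `|(X j *m W) 0 c| <= B) ->
  `|head_output P bias pat wval T X i h 0 c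
    - \sum_j (cat_idx i j \in eqclass (pat h))%:R * (X j *m W) 0 c|
    <= #|idx n k|%:R * (#|idx n k|%:R * expR (- T) * B).
Proof.
move=> ip wE XB; rewrite /head_output summxE -sumrB; apply: normr_sum_le => j.
rewrite mxE wE -scalemxAr [(_ *: (_ *m _)) _ _]mxE mulrA -mulrBl normrM.
by rewrite ler_pM // mulrC attn_fiber.
Qed.
End HeadError.

(** * Choice of the constants and assembly of the layer *)

Unset Implicit Arguments.
Set Strict Implicit.

Theorem theorem1 (R : realType)
  (sigma : R -> R) (sigma_cont : continuous sigma)
  (sigma_nonpoly : ~ exists p : {poly R}, forall x, sigma x = p.[x])
  (n k d dp : nat) (hn : (0 < n)%N) (hk : (0 < k)%N) (hd : (0 < d)%N)
  (hdp : (n <= dp)%N)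
  (P : 'M[R]_(n, dp)) (hP : P *m P^T = 1%:M)
  (w : {set idx n (k + k)} -> 'M[R]_(d, d)) (b : {set idx n k} -> 'rV[R]_d)
  (K : set {ptws idx n k -> 'rV[R]_d}) (hK : compact K)
  (delta : R) (hdelta : 0 < delta) :
  exists (de : nat) (E : {set idx n k} -> 'rV[R]_de)
         (r : nat) (win : 'M[R]_(d + k * dp + de, d + r))
         (dH dv : nat) (hs : 'I_(bell (2 * k)) -> attn_head R (d + r)%N dH dv)
         (m : nat) (M : mlp R (d + r)%N m),
    (0 < dH)%N /\
    forall X : idx n k -> 'rV[R]_d, K X ->
    forall i : idx n k,
      eucl_dist (lsubmx (transformer sigma hs M
               (fun j => augment P E X j *m win) i))
            (eq_layer w b X i) <= delta.
Proof.
set H := bell (2 * k); set N : R := #|idx n k|%:R.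
have [BX BX0 XB] := compact_coord_bounded hK.
have [B B0 XwB] : exists2 B : R, 0 < B & forall X, K X -> forall j mu c,
    `|(X j *m w mu) 0 c| <= B.
  exists (1 + d%:R * (BX * \sum_mu \sum_a \sum_c `|w mu a c|)).
    by rewrite ltr_pwDl // !mulr_ge0 ?(ltW BX0) //; do !apply: sumr_ge0 => ? _.
  move=> X KX j mu c; apply: (@le_trans _ _ (d%:R * (BX * \sum_mu \sum_a \sum_c `|w mu a c|))).
    rewrite mxE -[X in X%:R * _](card_ord d); apply: normr_sum_le => a.
    rewrite normrM ler_pM ?XB // (bigD1 mu) //= (bigD1 a) //= (bigD1 c) //=.
    by rewrite -!addrA lerDl !addr_ge0 //; do !apply: sumr_ge0 => ? _.
  by rewrite lerDr.
(* Surplus heads get the empty set. For them alone [pat] takes its default, the count [cnt] is 0,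
   and so is the value weight. *)
pose mu (h : 'I_H) := nth finset.set0 (enum (Defs.classes n (k + k))) h.
pose pat h : idx n (k + k) := odflt [ffun=> Ordinal hn] [pick x in mu h].
have muE h : mu h = finset.set0 \/ mu h = eqclass (pat h).
  case: (ltnP h (size (enum (Defs.classes n (k + k))))) => hs; last first.
    by left; rewrite /mu nth_default.
  right; have := mem_nth finset.set0 hs; rewrite mem_enum -/(mu h) /pat.
  case/imsetP => x _ ->; case: pickP => [y /eqclass_eq -> //|/(_ x)].
  by rewrite eqclass_refl.
pose cnt h := #|[set j | cat_idx (lidx (pat h)) j \in mu h]|.
pose wval h : 'M[R]_d := (cnt h)%:R *: w (mu h).
have N0 : 0 <= N by rewrite /N ler0n.
have cntN h : (cnt h)%:R <= N by rewrite /N ler_nat max_card.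
have d0 : 0 < d%:R :> R by rewrite ltr0n.
(* [eucl_dist_le] loses a factor [d]. Each head then spends [dg] on its gate and [dg] on its
   attention; [H.+1] makes the denominator visibly positive. *)
pose eta := delta / d%:R.
have eta0 : 0 < eta by rewrite divr_gt0.
pose H1 : R := H.+1%:R.
have H10 : 0 < H1 by rewrite /H1 ltr0n.
pose dg := eta / (2 * H1).
have dg0 : 0 < dg by apply: divr_gt0 => //; apply: mulr_gt0.
(* [N * N * B] bounds the head outputs: one [N] for the sum over tokens, one for [cnt]. The minimum
   with 1 in [e0 = expR (- T)] makes [T] nonnegative. *)
have NB0 : 0 < N * N * B + 1 by rewrite ltr_wpDl // !mulr_ge0 // ltW.
pose e0 := Num.min 1 (dg / (N * N * B + 1)).
have e00 : 0 < e0 by rewrite lt_min ltr01 divr_gt0.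
pose T := - ln e0.
have T0 : 0 <= T by rewrite oppr_ge0 ln_le0 // ge_min lexx.
have eT : N * (N * expR (- T) * B) <= dg.
  rewrite /T opprK lnK ?posrE //.
  have : e0 <= dg / (N * N * B + 1) by rewrite ge_min lexx orbT.
  by rewrite ler_pdivlMr // => he; lra.
have [Q [gc [ga [gb [ge [gate0 gate1]]]]]] :=
  gate_network sigma_cont sigma_nonpoly NB0 dg0.
exists #|{: {set idx n k}}|, (@class_code R n k), (d + k * dp + #|{: {set idx n k}}| + H * d)%N.
exists (@embed_in R n k d dp H b), (k * dp + #|{: {set idx n k}}|)%N, d.
exists (@head R n k d dp H pat wval T), _, (@gating_mlp R n k d dp H pat Q gc ga gb ge); split.
  by rewrite addn_gt0; apply/orP; right; apply/card_gt0P; exists finset.set0.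
move=> X KX i.
have -> : delta = d%:R * eta by rewrite /eta mulrC divfK // gt_eqF.
apply: eucl_dist_le; first exact: ltW.
move=> c; rewrite transformerE eq_layerE opprD addrACA subrr add0r.
rewrite -(@sum_nth_padded R _ (Defs.classes n (k + k)) (fun m => \sum_j
   (cat_idx i j \in m)%:R * (X j *m w m) 0 c) finset.set0 H); first last.
- by apply: big1 => j _; rewrite inE mul0r.
- by rewrite /H mul2n -addnn; exact: card_classes_le_bell.
rewrite -sumrB; apply: (@le_trans _ _ (H%:R * (dg + dg))); last first.
  have -> : dg + dg = eta / H1 by rewrite /dg; field; rewrite gt_eqF.
  by rewrite mulrCA ler_piMr ?(ltW eta0) // ler_pdivrMr // mul1r ler_nat.
rewrite -[X in X%:R * _](card_ord H); apply: normr_sum_le => h.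
rewrite -/(mu h).
(* Off the class of [lidx (pat h)] the gate outputs exactly 0, and so does the layer's term for
   [mu h], since no [cat_idx i j] lies in [mu h]. *)
case: (boolP (eqclass i == eqclass (lidx (pat h)))) => [/eqP ip|ip]; last first.
  under eq_bigr do rewrite mulr0 addr0.
  rewrite gate0 sub0r normrN big1 ?normr0 ?addr_ge0 // ?ltW // => j _.
  case: (boolP (cat_idx i j \in mu h)) => [|_]; last by rewrite mul0r.
  case: (muE h) => ->; first by rewrite inE.
  rewrite -{1}(cat_lridx (pat h)) => /cat_eqclass[/eqclass_eq ip'].
  by rewrite ip' eqxx in ip.
under eq_bigr do rewrite mulr1.
have {}ip : i \in eqclass (lidx (pat h)) by rewrite -ip eqclass_refl.
set out := head_output _ _ _ _ _ _ _ _ _ _.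
have outB : `|out| <= N * N * B + 1.
  apply: (@le_trans _ _ (N * (N * B))); last by rewrite mulrA lerDl.
  apply: head_output_bound => j; rewrite -scalemxAr mxE normrM normr_nat.
  by rewrite ler_pM // XwB.
have outE : `|out - \sum_j (cat_idx i j \in mu h)%:R * (X j *m w (mu h)) 0 c| <= dg.
  case: (muE h) => E.
    have -> : out = 0.
      rewrite /out /head_output summxE big1 // => j _.
      rewrite /wval /cnt E [X in X%:R](_ : _ = 0%N) ?scale0r ?mulmx0 ?scaler0 ?mxE //.
      by apply: eq_card0 => j'; rewrite !inE.
    rewrite big1 ?subr0 ?normr0 ?ltW // => j _.
    by rewrite E inE mul0r.
  apply: le_trans eT; rewrite [in X in _ - X]E.
  apply: head_output_error => //.
    by rewrite /wval /cnt E.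
  by move=> j; apply: XwB.
set S := \sum_q _; set V := \sum_j _ in outE *.
have -> : S - V = (S - out) + (out - V) by ring.
apply: le_trans (ler_normD _ _) _; apply: lerD => //; exact: gate1.
Qed.
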